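(* Let $\varepsilon$ be a real number with $0<\varepsilon<1$. Then there is a constant $C(\varepsilon)>0$, depending only on $\varepsilon$, such that the following holds. Let $x$ and $z$ be real numbers with $x\geq 3$ and $(\ln x)^{\varepsilon}\leq z\leq x$. Let $k$ be a positive integer and let $a,b_1,\ldots,b_k$ be integers with $a\geq 1$ and $|b_i|\leq x$ for all $1\leq i\leq k$. Let $\mathcal{L}=\{L_1,\ldots,L_k\}$ be a set of $k$ linear functions, where $L_i(n)=an+b_i$, $i=1,\ldots,k$. For $L(n)=an+b$, $b\in\mathbb{Z}$, define \[ \Delta_L=a^{k+1}\prod_{i=1}^{k}|b_i-b|. \] Let $s$ be a positive integer. Then \[ \sum_{\substack{-z\leq b\leq z\\ L(n)=an+b\notin\mathcal{L}}}\left(\frac{\Delta_L}{\varphi(\Delta_L)}\right)^{s}\leq\left(C(\varepsilon)\frac{a}{\varphi(a)}\ln(k+1)\right)^{s}s!\,z, \] where the sum is over integers $b$ with $-z\leq b\leq z$ such that the linear function $L(n)=an+b$ does not belong to $\mathcal{L}$.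
   Context: $\varphi$ is Euler's totient function; $\ln$ is the natural logarithm. *)

(* Defs.v *)
From mathcomp Require Import all_boot all_order all_algebra.
From mathcomp Require Import all_classical all_reals all_analysis.

Set Implicit Arguments.
Unset Strict Implicit.
Unset Printing Implicit Defensive.

Import Order.TTheory GRing.Theory Num.Theory.
Local Open Scope ring_scope.

Definition linear_fun (a : nat) (b : int) : int -> int := fun n => a%:Z * n + b.

(* Natural-number valued (absz), so that the totient of prime.v applies. *)
Definition Delta (a k : nat) (b : 'I_k -> int) (c : int) : nat :=
  (a ^ k.+1 * \prod_(i < k) `|b i - c|)%N.

(* Main.v *)
Require Import Defs.
From mathcomp Require Import all_boot all_order all_algebra.
From mathcomp Require Import all_classical all_reals all_analysis.
From mathcomp Require Import zify ring lra.


(** The ratio n / phi(n) is the product of p / (p - 1) over the primes p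
dividing n, so it is at most e times exp (sum_(p | n) 1 / p): the whole
question is about sums of reciprocals of primes.  It is submultiplicative, so
the factor a ^ (k + 1) of Delta contributes a / phi(a) once, and it remains to
bound the s-th moment of the ratio for P(c) = prod_i |b_i - c|, with c running
over the integers of absolute value at most N = floor z.  Put W = N + 1,
M = max (W, k + 1) and Y = k * W ^ A with A >= 1 / eps, so that
ln x <= W ^ A.

Primes p > M cost only a constant factor, for every single c.  Those above Y
are at most log_2 P(c) = O(k ln x) = O(Y) in number, hence their reciprocals
add up to O(1).  Those in (M, Y] have a reciprocal sum of at most
(sum_(p <= Y) ln p / p) / ln M <= (ln Y + ln 4) / ln M, and ln Y <=
(1 + A) ln M; this is where z is required to exceed a power of ln x
([totient_ratio_truncate]).

Primes p <= M are treated on average.  Let S_n be the sum of 1 / p over the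
primes p <= n dividing P(c).  Telescoping exp (s S_n) from n = k + 1 to M gives
exp (s S_M) <= exp (s S_(k+1)) + sum_(k+1 < p <= M, p | P(c))
(s / p) exp (s S_p).
By Mertens' upper bound exp S_n is at most C ln n, so the first term is already
(C ln (k + 1)) ^ s.  In the sum, a prime p > k + 1 is at most W and therefore
divides P(c) for only O(k W / p) values of c; what is left is the series
sum_(n > k+1) k (ln n) ^ s / n ^ 2, which is O(4 ^ s s! (ln (k + 1)) ^ s).  This
is where the factorial comes from ([moment_le]).

The two facts on primes, sum_(p <= n) ln p / p <= ln n + ln 4 and its
consequence sum_(p <= n) 1 / p <= ln ln n + O(1), follow from comparing n! with
its prime factorization and from the primorial bound
prod_(p <= n) p <= 4 ^ n. *)

Set Implicit Arguments.
Unset Strict Implicit.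
Unset Printing Implicit Defensive.

Import Order.TTheory GRing.Theory Num.Theory.
Local Open Scope classical_set_scope.
Local Open Scope ring_scope.

(** * Primorials and factorials *)

Lemma prod_primes_dvd (P : pred nat) (m n N : nat) :
  (forall p, (m <= p < n)%N -> P p -> prime p && (p %| N))%N ->
  (\prod_(m <= p < n | P p) p %| N)%N.
Proof.
elim: n => [|n IHn] PN; first by rewrite big_geq // dvd1n.
have [mn|nm] := leqP m n; last by rewrite big_geq // dvd1n.
rewrite big_mkcond big_nat_recr //= -big_mkcond /=.
have IH : (\prod_(m <= p < n | P p) p %| N)%N.
  by apply: IHn => p /andP[mp pn]; apply: PN; rewrite mp ltnW.
case: ifP => [Pn|_]; last by rewrite muln1.
have /andP[n_pr nN] := PN n (introT andP (conj mn (ltnSn n))) Pn.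
rewrite Gauss_dvd ?IH // big_seq_cond coprime_sym; apply: (big_ind (coprime n)).
- exact: coprimen1.
- by move=> x y; rewrite coprimeMr => -> ->.
- move=> p; rewrite mem_index_iota => /andP[/andP[mp pn] Pp].
  have /andP[p_pr _] := PN p (introT andP (conj mp (ltnW pn))) Pp.
  by rewrite prime_coprime // dvdn_prime2 // eq_sym ltn_eqF.
Qed.

(** The two equal middle binomial coefficients of the odd row 2 m + 1 together
make up at most 2 ^ (2 m + 1). *)
Lemma bin_odd_middle_le (m : nat) : ('C(m.*2.+1, m.+1) <= 4 ^ m)%N.
Proof.
have : (\sum_(i < m.*2.+2) 'C(m.*2.+1, i) = 2 ^ m.*2.+1)%N.
  by rewrite -[2%N]/(1 + 1)%N expnDn; apply: eq_bigr => i _; rewrite !exp1n !muln1.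
have lt1 : (m < m.*2.+2)%N by lia.
have lt2 : (m.+1 < m.*2.+2)%N by lia.
rewrite (bigD1 (Ordinal lt1)) //= (bigD1 (Ordinal lt2)) /=; last first.
  by apply/eqP => /(congr1 val) /=; lia.
rewrite -{1}(@bin_sub m.*2.+1 m); last by lia.
rewrite (_ : m.*2.+1 - m = m.+1)%N; last by lia.
have -> : (2 ^ m.*2.+1 = 2 * 4 ^ m)%N by rewrite expnS -mul2n expnM.
by move: (\sum_(i < _ | _) _)%N => u; lia.
Qed.

(** For odd n = 2 m + 1, the primes in (m + 1, n] divide (2 m + 1)! but neither
(m + 1)! nor m!, hence they all divide the middle binomial coefficient, which is
at most 4 ^ m.  The primes up to m + 1 are handled by induction, and an even
n > 2 is not prime. *)
Lemma primorial_le (n : nat) : (\prod_(0 <= p < n.+1 | prime p) p <= 4 ^ n)%N.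
Proof.
elim/ltn_ind: n => n IHn.
have [n_small|n_gt2] := leqP n 2.
  by case: n n_small {IHn} => [|[|[|]]] // _; rewrite unlock.
have [n_odd|n_even] := boolP (odd n); last first.
  have n_npr : ~~ prime n.
    by apply: contra n_even => /even_prime[nE|//]; rewrite nE in n_gt2.
  rewrite big_mkcond big_nat_recr //= -big_mkcond (negPf n_npr) muln1.
  case: n n_gt2 {n_even n_npr} IHn => // n n_gt2 IHn.
  by apply: leq_trans (IHn n _) _; rewrite ?leq_exp2l.
pose m := n./2.
have nE : n = m.*2.+1 by rewrite -[LHS]odd_double_half n_odd.
rewrite (@big_cat_nat _ _ _ m.+2) //=; last by lia.
have -> : (4 ^ n = 4 ^ m.+1 * 4 ^ m)%N by rewrite -expnD; congr (_ ^ _)%N; lia.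
apply: leq_mul; first by apply: IHn; lia.
apply: leq_trans (bin_odd_middle_le m); apply: dvdn_leq.
  by rewrite bin_gt0; lia.
apply: prod_primes_dvd => p /andP[mp pn] p_pr; rewrite p_pr /=.
have : (p %| n`!)%N by rewrite dvdn_fact //; have := prime_gt0 p_pr; lia.
rewrite nE -(@bin_fact m.*2.+1 m.+1); last by lia.
have not_dvd j : (j < p)%N -> ~~ (p %| j`!)%N.
  elim: j => [|j IHj] jp; first by rewrite dvdn1; have := prime_gt1 p_pr; lia.
  rewrite factS Euclid_dvdM // negb_or IHj 1?ltnW // andbT.
  by rewrite gtnNdvd.
rewrite Euclid_dvdM // => /orP[//|]; rewrite Euclid_dvdM // => /orP[] bad.
  by have := not_dvd _ mp; rewrite bad.
have lt_p : (m.*2.+1 - m.+1 < p)%N by lia.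
by have := not_dvd _ lt_p; rewrite bad.
Qed.

(** The exponent of p in n! is at least its first Legendre term, n / p. *)
Lemma prod_prime_pow_le_fact (n : nat) :
  (\prod_(0 <= p < n.+1 | prime p) p ^ (n %/ p) <= n`!)%N.
Proof.
rewrite -[leqRHS](partnT (fact_gt0 n)) (widen_partn _ (leqnn _)).
have n_le : (n.+1 <= n`!.+1)%N.
  by case: n => // n; rewrite factS ltnS leq_pmulr ?fact_gt0.
rewrite [leqRHS](@big_cat_nat _ _ _ n.+1) //=.
rewrite -[leqLHS]muln1; apply: leq_mul; last first.
  by rewrite big_mkcond prodn_gt0 // => p; rewrite /= expn_gt0; case: p => //=; rewrite lognE.
rewrite big_mkcond; apply: leq_prod => p _ /=.
case: ifP => [p_pr|]; last first.
  by move=> np; rewrite lognE np.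
apply: leq_pexp2l; first exact: prime_gt0.
have [->|n_gt0] := posnP n; first by rewrite div0n.
by rewrite logn_fact // big_ltn //= expn1 leq_addr.
Qed.

(** * Mertens' upper bound *)

(** From exp (- 1 / 2) >= 1 - 1 / 2. *)
Lemma ln2_ge_half (R : realType) : 2^-1 <= ln (2 : R).
Proof.
rewrite -ler_expR lnK ?posrE //.
have := @expR_ge1Dx R (- 2^-1); rewrite expRN.
have e0 := expR_gt0 (2^-1 : R).
rewrite -(ler_pM2r e0) mulVf ?gt_eqF //; lra.
Qed.

(** Transfers the integer product bounds above to sums of logarithms. *)
Lemma sum_ln_le (R : realType) (I : Type) (r : seq I) (P : pred I) (v e : I -> nat) (m : nat) :
  (forall i, P i -> (0 < v i)%N) -> (\prod_(i <- r | P i) v i ^ e i <= m)%N ->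
  \sum_(i <- r | P i) (e i)%:R * ln ((v i)%:R : R) <= ln (m%:R : R).
Proof.
move=> v0 le_m.
have m_gt0 : (0 < m)%N.
  apply: leq_trans le_m; rewrite (big_ind (fun n => 0 < n)%N) // => [x y|i Pi].
    by rewrite muln_gt0 => -> ->.
  by rewrite expn_gt0 v0.
rewrite -ler_expR lnK ?posrE ?ltr0n // expR_sum.
rewrite (eq_bigr (fun i => ((v i ^ e i)%N%:R))); last first.
  by move=> i Pi; rewrite expRM_natl lnK ?natrX // posrE ltr0n v0.
by rewrite -natr_prod ler_nat.
Qed.

Lemma fact_le_expn (n : nat) : (n`! <= n ^ n)%N.
Proof.
rewrite fact_prod -[X in (_ <= _ ^ X)%N](subn0 n) -prod_nat_const_nat big_add1 /=.
rewrite big_nat [leqRHS]big_nat.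
by apply: leq_prod => i /andP[].
Qed.

Definition prime_log_sum (R : realType) (n : nat) : R :=
  \sum_(0 <= p < n.+1 | prime p) ln (p%:R : R) / p%:R.

Definition recip_sum (R : realType) (Q : pred nat) (n : nat) : R :=
  \sum_(0 <= p < n.+1 | Q p) (p%:R : R)^-1.

(** Taking logarithms in prod_(p <= n) p ^ floor (n / p) <= n! <= n ^ n and using
floor (n / p) >= n / p - 1 bounds n * sum ln p / p by n ln n + sum ln p; the
primorial bound absorbs the last sum. *)
Lemma prime_log_sum_le (R : realType) (n : nat) :
  (0 < n)%N -> prime_log_sum R n <= ln (n%:R : R) + ln 4.
Proof.
move=> n_gt0; have nR : 0 < n%:R :> R by rewrite ltr0n.
rewrite -(ler_pM2l nR) /prime_log_sum mulr_sumr.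
have step : \sum_(0 <= p < n.+1 | prime p) n%:R * (ln (p%:R : R) / p%:R) <=
    \sum_(0 <= p < n.+1 | prime p) (n %/ p)%N%:R * ln (p%:R : R) +
    \sum_(0 <= p < n.+1 | prime p) 1%N%:R * ln (p%:R : R).
  rewrite -big_split /=; apply: ler_sum => p p_pr.
  have p_gt0 : 0 < p%:R :> R by rewrite ltr0n prime_gt0.
  have lnp : 0 <= ln (p%:R : R) by rewrite ln_ge0 // ler1n prime_gt0.
  rewrite mulrCA mulrC -mulrDl; apply: ler_wpM2r => //.
  rewrite ler_pdivrMr // -natrD -natrM ler_nat addn1.
  by apply: ltnW; rewrite ltn_ceil // prime_gt0.
apply: le_trans step _; rewrite mulrDr; apply: lerD.
  apply: le_trans (sum_ln_le _ _ (prod_prime_pow_le_fact n)) _.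
    by move=> p; apply: prime_gt0.
  apply: le_trans (_ : ln ((n ^ n)%N%:R : R) <= _).
    by rewrite ler_ln ?posrE ?ltr0n ?fact_gt0 ?expn_gt0 ?n_gt0 // ler_nat fact_le_expn.
  by rewrite natrX lnXn // mulr_natl.
apply: le_trans (@sum_ln_le R _ _ _ id (fun=> 1%N) (4 ^ n) _ _) _.
- by move=> p; apply: prime_gt0.
- by under eq_bigr do rewrite expn1; exact: primorial_le.
- by rewrite natrX lnXn // mulr_natl.
Qed.

Lemma recip_sumS (R : realType) (Q : pred nat) (n : nat) :
  recip_sum R Q n.+1 = recip_sum R Q n + (if Q n.+1 then n.+1%:R^-1 else 0).
Proof. by rewrite /recip_sum big_mkcond big_nat_recr //= -big_mkcond. Qed.

Lemma prime_log_sumS (R : realType) (n : nat) :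
  prime_log_sum R n.+1 = prime_log_sum R n + (if prime n.+1 then ln (n.+1%:R : R) / n.+1%:R else 0).
Proof. by rewrite /prime_log_sum big_mkcond big_nat_recr //= -big_mkcond. Qed.

(** Summation by parts in incremental form.  Passing from n to n + 1 changes the
left-hand side by B(n) (1 / ln n - 1 / ln (n + 1)), where B(n) is the sum of
ln p / p, because the contribution of n + 1 itself cancels.  With
B(n) <= ln n + ln 4 this is at most
1 - ln n / ln (n + 1) + ln 4 (1 / ln n - 1 / ln (n + 1)),
and 1 - u / v <= ln v - ln u makes the first part telescope to ln ln.
The constant is fixed by equality at n = 2, where the left-hand side is 0. *)
Lemma recip_prime_abel (R : realType) (n : nat) : (2 <= n)%N ->
  recip_sum R prime n - prime_log_sum R n / ln n%:R <=
  ln (ln n%:R) - ln 4 / ln n%:R + (2 - ln (ln 2)).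
Proof.
have ln2 := ln2_ge_half R.
have ln4 : ln (4 : R) = 2 * ln 2.
  by rewrite (_ : 4 = 2 * 2 :> R) ?lnM ?posrE //; ring.
elim: n => // -[|[|n]] // IHn _.
  have -> : recip_sum R prime 2 = 2^-1.
    by rewrite /recip_sum big_mkcond !big_nat_recr ?big_geq //= !add0r.
  have -> : prime_log_sum R 2 = ln 2 / 2.
    by rewrite /prime_log_sum big_mkcond !big_nat_recr ?big_geq //= !add0r.
  have -> : ln 2 / 2 / ln 2 = 2^-1 :> R by field; rewrite gt_eqF; lra.
  by rewrite ln4 mulfK ?gt_eqF; lra.
have {}IHn := IHn isT.
set u : R := ln n.+2%:R in IHn *; set v : R := ln n.+3%:R.
have u_ge : 2^-1 <= u.
  by apply: le_trans ln2 _; rewrite ler_ln ?posrE ?ltr0n // ler_nat.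
have uv : u <= v by rewrite ler_ln ?posrE ?ltr0n // ler_nat.
have u0 : 0 < u by lra.
have v0 : 0 < v by lra.
have iuv : 0 <= u^-1 - v^-1 by rewrite subr_ge0 lef_pV2.
have B := @prime_log_sum_le R n.+2 isT.
rewrite -/u in B.
have step : recip_sum R prime n.+3 - prime_log_sum R n.+3 / v =
    (recip_sum R prime n.+2 - prime_log_sum R n.+2 / u) + prime_log_sum R n.+2 * (u^-1 - v^-1).
  rewrite recip_sumS prime_log_sumS -/v; case: ifP => _; last by ring.
  by field; rewrite !gt_eqF //= ltr0n.
have lnuv : 1 - u / v <= ln v - ln u.
  have := @le_ln1Dx R (u / v - 1); rewrite addrCA subrr addr0 ln_div ?posrE //.
  move=> h; have : -1 < u / v - 1 by have : 0 < u / v by [rewrite divr_gt0]; lra.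
  by move/h; lra.
have := ler_wpM2r iuv B.
rewrite step mulrDl [u * _]mulrBr divff ?gt_eqF // mulrBr.
lra.
Qed.

(** Mertens' upper bound: the coefficient of ln ln is exactly 1, which is what
makes the final estimate linear in ln (k + 1) before taking the s-th power. *)
Lemma recip_prime_le (R : realType) (n : nat) : (2 <= n)%N ->
  recip_sum R prime n <= ln (ln n%:R) + (3 - ln (ln 2)).
Proof.
move=> n2; have := recip_prime_abel R n2.
have u0 : 0 < ln n%:R :> R by rewrite ln_gt0 // ltr1n.
have := @prime_log_sum_le R n (ltnW n2).
rewrite -(ler_pM2r (_ : 0 < (ln n%:R)^-1 :> R)) ?invr_gt0 // mulrDl divff ?gt_eqF //.
lra.
Qed.

Lemma expR_recip_prime_le (R : realType) :
  exists2 C : R, 0 < C & forall n, (2 <= n)%N -> expR (recip_sum R prime n) <= C * ln n%:R.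
Proof.
exists (expR (3 - ln (ln 2))); first exact: expR_gt0.
move=> n n2; have u0 : 0 < ln n%:R :> R by rewrite ln_gt0 // ltr1n.
by rewrite -[X in _ * X](@lnK R) ?posrE // -expRD ler_expR addrC recip_prime_le.
Qed.

Lemma recip_sum_le (R : realType) (Q Q' : pred nat) (n : nat) :
  (forall p, Q p -> Q' p) -> recip_sum R Q n <= recip_sum R Q' n.
Proof.
move=> sQ; rewrite /recip_sum big_mkcond [leRHS]big_mkcond; apply: ler_sum => p _ /=.
case: ifP => [/sQ ->//|_]; case: ifP => // _; by rewrite invr_ge0.
Qed.

Lemma recip_sum_homo (R : realType) (Q : pred nat) (m n : nat) :
  (m <= n)%N -> recip_sum R Q m <= recip_sum R Q n.
Proof.
move=> mn; rewrite /recip_sum [leRHS](@big_cat_nat _ _ _ m.+1) //=.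
by rewrite lerDl sumr_ge0 // => p _; rewrite invr_ge0.
Qed.

(** For p > m one has 1 / p <= (ln p / p) / ln m.  On a range [m, m ^ O(1)] this
turns the upper bound for the sum of ln p / p into a constant bound. *)
Lemma recip_sum_middle (R : realType) (Q : pred nat) (m n : nat) :
  (forall p, Q p -> prime p) -> (2 <= m)%N -> (0 < n)%N ->
  recip_sum R Q n <= recip_sum R Q m + (ln n%:R + ln 4) / ln m%:R.
Proof.
move=> Qpr m2 n0.
have u0 : 0 < ln m%:R :> R by rewrite ln_gt0 // ltr1n.
have B := @prime_log_sum_le R n n0.
have b0 : 0 <= ln n%:R + ln 4 :> R by rewrite addr_ge0 // ln_ge0 ?ler1n.
have [nm|mn] := leqP n m.
  apply: le_trans (recip_sum_homo R Q nm) _.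
  by rewrite lerDl divr_ge0 // ltW.
rewrite /recip_sum (@big_cat_nat _ _ _ m.+1) //=; last exact: ltnW.
rewrite lerD2l ler_pdivlMr //; apply: le_trans B; rewrite mulr_suml.
rewrite /prime_log_sum [leRHS](@big_cat_nat _ _ _ m.+1) //=; last exact: ltnW.
rewrite ler_wpDl //.
  apply: sumr_ge0 => p p_pr; rewrite divr_ge0 // ln_ge0 // ler1n; exact: prime_gt0.
rewrite big_mkcond [leRHS]big_mkcond big_nat [leRHS]big_nat.
apply: ler_sum => p /andP[mp pn].
case: ifP => [/Qpr p_pr|_]; last first.
  by case: ifP => // /prime_gt0 p0; rewrite divr_ge0 // ln_ge0 // ler1n.
rewrite p_pr mulrC ler_wpM2r ?invr_ge0 // ler_ln ?posrE ?ltr0n ?(prime_gt0 p_pr) ?(ltnW m2) //.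
by rewrite ler_nat ltnW.
Qed.

(** * The ratio of an integer to its totient *)

(** Sets of prime divisors of different integers become subsets of one common
interval, where the sums attached to them can be compared term by term. *)
Lemma big_primes (R : Type) (idx : R) (op : Monoid.com_law idx) (n m : nat) (F : nat -> R) :
  (n <= m)%N ->
  \big[op/idx]_(p <- primes n) F p = \big[op/idx]_(0 <= p < m.+1 | p \in primes n) F p.
Proof.
move=> nm; rewrite -[RHS]big_filter; apply: perm_big; apply: uniq_perm.
- exact: primes_uniq.
- by rewrite filter_uniq // iota_uniq.
- move=> p; rewrite mem_filter mem_index_iota /= ltnS.
  case: (boolP (p \in primes n)) => //; rewrite mem_primes => /and3P[_ n0 /(dvdn_leq n0) pn].
  by rewrite (leq_trans pn nm).
Qed.

(** An integer n has at most log_2 n prime divisors, and each of those above m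
contributes at most 1 / m. *)
Lemma sum_primes_le (R : realType) (n m : nat) : (0 < n)%N -> (0 < m)%N ->
  \sum_(p <- primes n) (p%:R : R)^-1 <=
  recip_sum R (fun p => p \in primes n) m + 2 * ln n%:R / m%:R.
Proof.
move=> n0 m0.
have size_le : (size (primes n))%:R <= 2 * ln n%:R :> R.
  have : (\prod_(p <- primes n) 2 ^ 1 <= n)%N.
    rewrite [leqRHS]prod_prime_decomp // prime_decompE big_map /=.
    rewrite big_seq [leqRHS]big_seq; apply: leq_prod => p p_n.
    have := p_n; rewrite mem_primes => /and3P[p_pr _ _].
    rewrite expn1; apply: leq_trans (prime_gt1 p_pr) _.
    by rewrite -{1}[p]expn1 leq_exp2l ?prime_gt1 // logn_gt0.
  move/(@sum_ln_le R _ _ predT (fun=> 2%N) (fun=> 1%N)) => /(_ (fun _ _ => isT)).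
  rewrite big_const_seq count_predT iter_addr_0 -[_ *+ _]mulr_natl mul1r => h.
  have := ler_wpM2l (ler0n R (size (primes n))) (ln2_ge_half R).
  lra.
rewrite (bigID (fun p => p <= m)%N) /=; apply: lerD.
  rewrite /recip_sum -big_filter -[leRHS]big_filter le_eqVlt; apply/orP; left; apply/eqP.
  apply: perm_big; apply: uniq_perm.
  - by rewrite filter_uniq // primes_uniq.
  - by rewrite filter_uniq // iota_uniq.
  - by move=> p; rewrite !mem_filter mem_index_iota /= ltnS andbC.
apply: le_trans (_ : \sum_(p <- primes n | ~~ (p <= m)%N) m%:R^-1 <= _).
  apply: ler_sum => p; rewrite -ltnNge => mp.
  by rewrite lef_pV2 ?posrE ?ltr0n // ?ler_nat ?(ltnW mp) // (leq_ltn_trans _ mp).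
rewrite big_const_seq iter_addr_0 -[_ *+ _]mulr_natl ler_wpM2r ?invr_ge0 //.
by apply: le_trans size_le; rewrite ler_nat count_size.
Qed.

Lemma totient_ratioE (R : realType) (n : nat) : (0 < n)%N ->
  n%:R / (totient n)%:R = \prod_(p <- primes n) (p%:R / p.-1%:R) :> R.
Proof.
move=> n0; rewrite totientE // {1}(prod_prime_decomp n0) prime_decompE big_map /=.
rewrite !natr_prod -prodf_div big_seq [RHS]big_seq; apply: eq_bigr => p p_n.
have := p_n; rewrite mem_primes => /and3P[p_pr _ _].
have : (0 < logn p n)%N by rewrite logn_gt0.
case: (logn p n) => // e _ /=; rewrite expnS !natrM -mulf_div divff ?mulr1 //.
by rewrite pnatr_eq0 expn_eq0 negb_and -lt0n prime_gt0.
Qed.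

Lemma prime_ratio_ge1 (R : realType) (p : nat) : prime p -> 1 <= p%:R / p.-1%:R :> R.
Proof.
move=> p_pr; have := prime_gt1 p_pr => p1.
by rewrite ler_pdivlMr ?mul1r ?ler_nat ?leq_pred // ltr0n -subn1 subn_gt0.
Qed.

(** The ratio only depends on the set of prime divisors, and every factor
p / (p - 1) is at least 1. *)
Lemma totient_ratio_union (R : realType) (m a b : nat) : (0 < m)%N -> (0 < a)%N -> (0 < b)%N ->
  (forall p, p \in primes m -> (p \in primes a) || (p \in primes b)) ->
  m%:R / (totient m)%:R <= (a%:R / (totient a)%:R) * (b%:R / (totient b)%:R) :> R.
Proof.
move=> m0 a0 b0 sub; rewrite !totient_ratioE //.
pose N := (m + a + b)%N.
rewrite !(@big_primes _ _ _ _ N) /N; try lia.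
rewrite big_mkcond [in leRHS]big_mkcond [X in _ <= _ * X]big_mkcond -big_split /=.
apply: ler_prod => p _.
have pr c : p \in primes c -> 1 <= p%:R / p.-1%:R :> R.
  by rewrite mem_primes => /and3P[/(@prime_ratio_ge1 R)].
have := sub p; case: ifP => [pm /(_ isT)|_ _].
  have := pr _ pm => r1; rewrite (le_trans _ r1) //=.
  case: ifP => pa; case: ifP => pb //= _; rewrite ?mulr1 ?mul1r //.
  by rewrite ler_peMl // (le_trans _ r1).
rewrite ler01 /=.
by case: ifP => [/pr pa|_]; case: ifP => [/pr pb|_]; rewrite ?mulr1 ?mul1r // mulr_ege1.
Qed.

Lemma sum_pred_recip_le (R : realType) (Q : pred nat) (n : nat) :
  (forall p, Q p -> prime p) ->
  \sum_(0 <= p < n.+2 | Q p) ((p.-1)%:R^-1 - p%:R^-1) <= 1 - n.+1%:R^-1 :> R.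
Proof.
move=> Qpr; have Q0 : ~~ Q 0 by apply/negP => /Qpr.
have Q1 : ~~ Q 1 by apply/negP => /Qpr.
elim: n => [|n IHn].
  by rewrite big_mkcond !big_nat_recr ?big_geq //= (negPf Q0) (negPf Q1) !addr0 invr1 subrr.
rewrite big_mkcond big_nat_recr //= -big_mkcond /=.
have : 0 <= n.+1%:R^-1 - n.+2%:R^-1 :> R.
  by rewrite subr_ge0 lef_pV2 ?posrE ?ltr0n // ler_nat.
move=> d_ge0; case: ifP => _.
  by apply: le_trans (lerD IHn (lexx _)) _; rewrite addrA subrK.
by rewrite addr0; apply: le_trans IHn _; rewrite lerB // -subr_ge0.
Qed.

(** Since p / (p - 1) = 1 + 1 / (p - 1) <= exp (1 / (p - 1)), and replacing
1 / (p - 1) by 1 / p costs at most sum_(n >= 2) 1 / (n (n - 1)) = 1. *)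
Lemma totient_ratio_le_expR (R : realType) (n : nat) : (0 < n)%N ->
  n%:R / (totient n)%:R <= expR (1 + \sum_(p <- primes n) (p%:R)^-1) :> R.
Proof.
move=> n0; rewrite totient_ratioE //.
apply: le_trans (_ : expR (\sum_(p <- primes n) (p.-1%:R)^-1) <= _).
  rewrite expR_sum big_seq [leRHS]big_seq; apply: ler_prod => p.
  rewrite mem_primes => /and3P[p_pr _ _].
  rewrite divr_ge0 //=; have p1 := prime_gt1 p_pr.
  have p1R : 0 < p.-1%:R :> R by rewrite ltr0n; lia.
  apply: le_trans (expR_ge1Dx _).
  by rewrite -{1}[p]prednK ?(ltnW p1) // -natr1 mulrDl divff ?gt_eqF // mul1r.
rewrite ler_expR -lerBlDr -sumrB.
rewrite (@big_primes _ _ _ n n.+1) //.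
apply: le_trans (@sum_pred_recip_le R _ n _) _.
  by move=> p; rewrite mem_primes => /and3P[].
by rewrite lerBlDr lerDl invr_ge0.
Qed.

(** * Tools for the moment bound *)

(** One step of the telescoping: if j satisfies Q, then exp (t S_j) - exp (t S_(j-1))
= exp (t S_j) (1 - exp (- t / j)) <= (t / j) exp (t S_j).  Ordering by the largest
element j reduces a moment of the sum to first-moment information on each j,
so no joint divisibility by several primes has to be counted. *)
Lemma expR_recip_sum_le (R : realType) (Q : pred nat) (t : R) (m n : nat) :
  0 <= t -> (m <= n)%N ->
  expR (t * recip_sum R Q n) <= expR (t * recip_sum R Q m) +
    \sum_(m.+1 <= j < n.+1 | Q j) t / j%:R * expR (t * recip_sum R Q j).
Proof.
move=> t0; elim: n => [|n IHn]; first by rewrite leqn0 => /eqP->; rewrite big_geq // addr0.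
rewrite leq_eqVlt => /orP[/eqP<-|mn]; first by rewrite big_geq // addr0.
rewrite big_mkcond big_nat_recr //= -big_mkcond /= addrA.
have {}IHn := IHn mn.
case: ifP => Qn; last by rewrite recip_sumS Qn !addr0.
apply: le_trans (_ : expR (t * recip_sum R Q n) + t / n.+1%:R * expR (t * recip_sum R Q n.+1) <= _); last exact: lerD.
set y := t / n.+1%:R.
have -> : t * recip_sum R Q n = t * recip_sum R Q n.+1 - y.
  by rewrite recip_sumS Qn /y; ring.
rewrite expRD -[leLHS]mul1r [_ * expR (- y)]mulrC -mulrDl ler_wpM2r ?expR_ge0 //.
by have := expR_ge1Dx (- y); lra.
Qed.

(** The i that are counted lie in one residue class modulo n, so they are
determined by their quotients i / n, which run from 0 to m / n. *)
Lemma count_dvd_iota_le (e : int) (n m : nat) : (0 < n)%N ->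
  (count (fun i : nat => n %| `|e - i%:Z|)%N (iota 0 m.+1) <= m %/ n + 1)%N.
Proof.
move=> n0; rewrite -size_filter; set l := seq.filter _ _.
rewrite -(size_map (fun i => i %/ n)%N) addn1 -(size_iota 0 (m %/ n).+1).
apply: uniq_leq_size; last first.
  move=> q /mapP[i]; rewrite mem_filter mem_iota add0n ltnS => /andP[_ im] ->.
  by rewrite mem_iota /= ltnS leq_div2r.
rewrite map_inj_in_uniq ?filter_uniq ?iota_uniq // => i j.
rewrite !mem_filter => /andP[di _] /andP[dj _] eq_div.
suff eq_mod : (i %% n = j %% n)%N by rewrite (divn_eq i n) (divn_eq j n) eq_div eq_mod.
have : (n%:Z %| j%:Z - i%:Z)%Z.
  have -> : j%:Z - i%:Z = (e - i%:Z) - (e - j%:Z) by ring.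
  exact: rpredB.
by rewrite -eqz_mod_dvd => /eqP; rewrite !modz_nat => -[].
Qed.

Lemma expr_le_fact_expR (R : realType) (x : R) (s : nat) : 0 <= x -> x ^+ s <= s`!%:R * expR x.
Proof.
move=> x0; case: s => [|s]; first by rewrite expr0 mul1r -expR0 ler_expR.
rewrite mulrC -ler_pdivrMr ?ltr0n ?fact_gt0 //.
by apply: le_trans (expR_ge1Dxn s x0); rewrite lerDr.
Qed.

(** Comparison of n ^ (- 3 / 2) with the telescoping differences
2 (1 / sqrt (n - 1) - 1 / sqrt n). *)
Lemma sum_sqrt_div_sqr_le (R : realType) (m n : nat) : (0 < m)%N -> (m <= n)%N ->
  \sum_(m.+1 <= j < n.+1) Num.sqrt (j%:R : R) / j%:R ^+ 2 <=
  2 * ((Num.sqrt m%:R)^-1 - (Num.sqrt n%:R)^-1).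
Proof.
move=> m0; elim: n => [|n IHn]; first by rewrite leqNgt m0.
rewrite leq_eqVlt => /orP[/eqP<-|mn]; first by rewrite big_geq // subrr mulr0.
rewrite big_nat_recr //=.
apply: le_trans (lerD (IHn mn) (lexx _)) _.
have n0 : (0 < n)%N by exact: leq_trans m0 mn.
set a := Num.sqrt n%:R; set b := Num.sqrt n.+1%:R; set c := (Num.sqrt m%:R)^-1.
have a0 : 0 < a by rewrite sqrtr_gt0 ltr0n.
have ab : a <= b by rewrite ler_sqrt // ler_nat.
have b0 : 0 < b by apply: lt_le_trans ab.
have bb : b ^+ 2 = n.+1%:R by rewrite sqr_sqrtr // ler0n.
have aa : a ^+ 2 = n%:R by rewrite sqr_sqrtr // ler0n.
have step : b / (b ^+ 2) ^+ 2 <= 2 * (a^-1 - b^-1).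
  have -> : a^-1 - b^-1 = (a * b * (a + b))^-1.
    have : b ^+ 2 = a ^+ 2 + 1 by rewrite aa bb -natr1.
    move=> h; apply/eqP; rewrite -subr_eq0; apply/eqP.
    have -> : a^-1 - b^-1 - (a * b * (a + b))^-1 = (b ^+ 2 - a ^+ 2 - 1) / (a * b * (a + b)).
      by field; rewrite !gt_eqF //= addr_gt0.
    by rewrite h; field; rewrite !gt_eqF //= addr_gt0.
  have -> : b / (b ^+ 2) ^+ 2 = (b ^+ 3)^-1 by field; rewrite gt_eqF.
  rewrite ler_pdivlMr ?mulr_gt0 ?addr_gt0 // mulrC ler_pdivrMr ?exprn_gt0 //.
  have h1 : a * b <= b * b by rewrite ler_pM2r.
  have h2 : a + b <= 2 * b by lra.
  apply: le_trans (ler_pM _ _ h1 h2) _; rewrite ?mulr_ge0 ?addr_ge0 ?(ltW a0) ?(ltW b0) //.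
  by rewrite le_eqVlt; apply/orP; left; apply/eqP; ring.
by rewrite -bb; move: step; lra.
Qed.

(** Write j = K t with t >= 1.  As ln K >= 1 / 2, ln j <= ln K (1 + 2 ln t), and
((1 + 2 ln t) / 4) ^ s <= s! exp ((1 + 2 ln t) / 4) = s! exp (1 / 4) sqrt t.  The
loss of sqrt t still leaves the convergent series of K t ^ (1 / 2) / j ^ 2. *)
Lemma sum_ln_pow_le (R : realType) (K n s : nat) : (2 <= K)%N -> (K <= n)%N ->
  \sum_(K.+1 <= j < n.+1) K%:R / j%:R ^+ 2 * ln (j%:R : R) ^+ s <=
  2 * expR 4^-1 * (4 * ln K%:R) ^+ s * s`!%:R.
Proof.
move=> K2 Kn; have K0 : 0 < K%:R :> R by rewrite ltr0n ltnW.
have ln2 := ln2_ge_half R.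
have lnK_ge : 2^-1 <= ln (K%:R : R).
  by apply: le_trans ln2 _; rewrite ler_ln ?posrE // ler_nat.
have sK0 : 0 < Num.sqrt (K%:R : R) by rewrite sqrtr_gt0.
pose c : R := expR 4^-1 * (4 * ln K%:R) ^+ s * s`!%:R * Num.sqrt K%:R.
have c0 : 0 <= c.
  by rewrite /c !mulr_ge0 ?expR_ge0 ?sqrtr_ge0 ?exprn_ge0 // mulr_ge0 //; lra.
apply: le_trans (_ : \sum_(K.+1 <= j < n.+1) c * (Num.sqrt j%:R / j%:R ^+ 2) <= _).
  rewrite big_nat [leRHS]big_nat; apply: ler_sum => j /andP[Kj _].
  have j0 : 0 < j%:R :> R by rewrite ltr0n; apply: leq_trans Kj.
  pose t : R := j%:R / K%:R.
  have t0 : 0 < t by rewrite divr_gt0.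
  have t1 : 1 <= t by rewrite ler_pdivlMr // mul1r ler_nat ltnW.
  have lt0 := ln_ge0 t1.
  have lnj : ln (j%:R : R) = ln K%:R + ln t by rewrite -lnM ?posrE // /t mulrC divfK ?gt_eqF.
  have le1 : ln (j%:R : R) <= 4 * ln K%:R * ((1 + 2 * ln t) / 4) by rewrite lnj; nra.
  have x0 : 0 <= (1 + 2 * ln t) / 4 by lra.
  have sqt : expR ((1 + 2 * ln t) / 4) = expR 4^-1 * (Num.sqrt j%:R / Num.sqrt K%:R).
    have -> : (1 + 2 * ln t) / 4 = 4^-1 + ln t / 2 by field.
    rewrite expRD; congr (_ * _).
    rewrite -sqrtrV ?(ltW K0) // -sqrtrM ?(ltW j0) // -/t.
    apply: (@pexpIrn _ 2) => //; rewrite ?nnegrE ?expR_ge0 ?sqrtr_ge0 //.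
    by rewrite sqr_sqrtr ?(ltW t0) // -expRM_natl mulrC divfK // lnK.
  apply: le_trans (_ : K%:R / j%:R ^+ 2 * ((4 * ln K%:R) ^+ s * (s`!%:R * expR ((1 + 2 * ln t) / 4))) <= _).
    apply: ler_wpM2l; first by rewrite divr_ge0 ?exprn_ge0 ?ltW.
    apply: le_trans (_ : (4 * ln K%:R * ((1 + 2 * ln t) / 4)) ^+ s <= _).
      by apply: lerXn2r; rewrite ?nnegrE //; [rewrite lnj; lra | rewrite mulr_ge0 //; lra].
    rewrite exprMn; apply: ler_wpM2l; first by rewrite exprn_ge0 //; lra.
    exact: expr_le_fact_expR.
  rewrite sqt /c -{1}[K%:R]sqr_sqrtr ?(ltW K0) //.
  rewrite le_eqVlt; apply/orP; left; apply/eqP; field.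
  by rewrite !gt_eqF.
rewrite -mulr_sumr; have := sum_sqrt_div_sqr_le R (ltnW K2) Kn => /(ler_wpM2l c0) h.
apply: le_trans h _.
have : 0 <= (Num.sqrt n%:R)^-1 :> R by rewrite invr_ge0 sqrtr_ge0.
move=> /(mulr_ge0 c0) h.
have e : c * (Num.sqrt K%:R)^-1 = expR 4^-1 * (4 * ln K%:R) ^+ s * s`!%:R.
  by rewrite /c mulfK ?gt_eqF.
rewrite mulrCA mulrBr e; lra.
Qed.

(** * Moments over a window of integers *)

Definition int_window (N : nat) : seq int := [seq i%:Z - N%:Z | i <- iota 0 N.*2.+1].

Definition diff_prod (k : nat) (b : 'I_k -> int) (c : int) : nat := (\prod_(i < k) `|b i - c|)%N.

Lemma int_window_uniq (N : nat) : uniq (int_window N).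
Proof. by rewrite map_inj_uniq ?iota_uniq // => i j /addIr[]. Qed.

Lemma mem_int_window (N : nat) (c : int) : (`|c| <= N)%N -> c \in int_window N.
Proof.
move=> cN; apply/mapP; exists (absz (c + N%:Z)); last by lia.
by rewrite mem_iota; lia.
Qed.

Lemma count_int_window_dvd (e : int) (N n : nat) : (0 < n)%N ->
  (count (fun c : int => n %| `|e - c|)%N (int_window N) <= N.*2 %/ n + 1)%N.
Proof.
move=> n0; rewrite count_map; apply: leq_trans (count_dvd_iota_le (e + N%:Z) N.*2 n0).
by apply/eq_leq/eq_count => i /=; rewrite opprB addrA.
Qed.

(** A prime dividing the product divides one of the k differences. *)
Lemma count_diff_prod_primes (k : nat) (b : 'I_k -> int) (N n : nat) :
  (count (fun c => n \in primes (diff_prod b c)) (int_window N) <= k * (N.*2 %/ n + 1))%N.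
Proof.
have [n_pr|n_npr] := boolP (prime n); last first.
  rewrite (@eq_count _ _ pred0) ?count_pred0 // => c /=.
  by rewrite mem_primes (negPf n_npr).
have n0 := prime_gt0 n_pr.
apply: leq_trans (_ : \sum_(i < k) count (fun c : int => n %| `|b i - c|)%N (int_window N) <= _)%N; last first.
  apply: leq_trans (_ : \sum_(i < k) (N.*2 %/ n + 1) <= _)%N; last by rewrite sum_nat_const card_ord.
  by apply: leq_sum => i _; apply: count_int_window_dvd.
elim: (int_window N) => [|c l IHl] /=; first by rewrite big1.
rewrite big_split /=; apply: leq_add IHl.
case: (boolP (n \in primes _)) => //.
rewrite mem_primes => /and3P[_ _]; rewrite /diff_prod Euclid_dvd_prod //.
rewrite big_has => /hasP[i _ ni].
by rewrite (bigD1 i) //= ni.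
Qed.

(** The average treatment of the primes up to max (N + 1, k + 1).  The first term
of the telescoping, for the primes up to k + 1, is bounded uniformly in c; a prime
j > k + 1 that still counts satisfies j <= N + 1, so that the bound
k (2 N / j + 1) on the number of c with j | diff_prod b c is at most
3 k (N + 1) / j. *)
Lemma moment_le (R : realType) : exists2 C : R, 0 < C &
  forall (N k : nat) (b : 'I_k -> int) (s : nat), (1 <= k)%N -> (1 <= s)%N ->
  \sum_(c <- int_window N)
     expR (s%:R * recip_sum R (fun p => p \in primes (diff_prod b c)) (maxn N.+1 k.+1))
  <= (C * ln k.+1%:R) ^+ s * s`!%:R * N.+1%:R.
Proof.
have [C0 C0_gt0 HC0] := expR_recip_prime_le R.
pose c1 : R := 2 * expR 4^-1.
have c1_gt0 : 0 < c1 by rewrite mulr_gt0 // expR_gt0.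
exists (8 * C0 * (2 + 3 * c1)); first by rewrite !mulr_gt0 //; lra.
move=> N k b s k1 s1; set M := maxn _ _; pose K := k.+1.
have K2 : (2 <= K)%N by [].
have KM : (K <= M)%N by rewrite leq_maxr.
pose L : R := ln K%:R; have L0 : 0 < L by rewrite ln_gt0 // ltr1n.
pose Q c p := p \in primes (diff_prod b c).
have exp_le c n : (2 <= n)%N -> expR (s%:R * recip_sum R (Q c) n) <= (C0 * ln n%:R) ^+ s.
  move=> n2; rewrite expRM_natl; apply: lerXn2r; rewrite ?nnegrE ?expR_ge0 //.
    by rewrite mulr_ge0 ?(ltW C0_gt0) // ln_ge0 // ler1n ltnW.
  apply: le_trans (HC0 n n2); rewrite ler_expR; apply: recip_sum_le => p.
  by rewrite /Q mem_primes => /and3P[].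
have pointwise c : expR (s%:R * recip_sum R (Q c) M) <= (C0 * L) ^+ s +
    \sum_(K.+1 <= j < M.+1) (Q c j)%:R * (s%:R / j%:R * (C0 * ln j%:R) ^+ s).
  apply: le_trans (expR_recip_sum_le (Q c) (ler0n R s) KM) _.
  apply: lerD; first exact: exp_le.
  rewrite big_mkcond big_nat [leRHS]big_nat; apply: ler_sum => j /andP[Kj _] /=.
  case: (Q c j); last by rewrite mul0r.
  rewrite mul1r; apply: ler_wpM2l; first by rewrite divr_ge0.
  by apply: exp_le; apply: leq_trans (ltnW Kj).
apply: le_trans (ler_sum _ (fun c _ => pointwise c)) _.
rewrite big_split /= big_const_seq count_predT size_map size_iota iter_addr_0.
rewrite exchange_big /=.
have fact1 : 1 <= s`!%:R :> R by rewrite ler1n fact_gt0.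
have NS : 0 < N.+1%:R :> R by rewrite ltr0n.
(* Common size of both parts, up to s-th powers of absolute constants. *)
pose T : R := C0 ^+ s * L ^+ s * s`!%:R * N.+1%:R.
have T0 : 0 <= T by rewrite !mulr_ge0 ?exprn_ge0 ?ltW //; lra.
have part1 : (C0 * L) ^+ s *+ N.*2.+1 <= 2 * T.
  rewrite exprMn -mulr_natr.
  apply: le_trans (_ : C0 ^+ s * L ^+ s * (2 * N.+1%:R) <= _).
    apply: ler_wpM2l; first by rewrite mulr_ge0 ?exprn_ge0 ?ltW.
    by rewrite -natrM ler_nat; lia.
  have -> : 2 * T = C0 ^+ s * L ^+ s * (2 * N.+1%:R) * s`!%:R by rewrite /T; ring.
  by rewrite ler_peMr // !mulr_ge0 ?exprn_ge0 ?ltW.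
have part2 : \sum_(K.+1 <= j < M.+1) \sum_(c <- int_window N)
    (Q c j)%:R * (s%:R / j%:R * (C0 * ln j%:R) ^+ s) <= 3 * c1 * 8 ^+ s * T.
  apply: le_trans (_ : \sum_(K.+1 <= j < M.+1) 3 * N.+1%:R * s%:R * C0 ^+ s * (K%:R / j%:R ^+ 2 * ln j%:R ^+ s) <= _).
    rewrite big_nat [leRHS]big_nat; apply: ler_sum => j /andP[Kj jM].
    have j0 : (0 < j)%N by apply: leq_trans Kj.
    have jR : 0 < j%:R :> R by rewrite ltr0n.
    have jN : (j <= N.+1)%N by move: jM Kj; rewrite /M /K; lia.
    rewrite -mulr_suml.
    have -> : \sum_(c <- int_window N) (Q c j)%:R = (count (fun c => Q c j) (int_window N))%:R :> R.
      by rewrite -natr_sum -sum1_count [in RHS]big_mkcond; congr (_%:R); apply: eq_bigr => c _; case: (Q c j).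
    (* j <= N + 1 turns 2 N / j + 1 into 3 (N + 1) / j. *)
    have cnt : (count (fun c => Q c j) (int_window N))%:R <= K%:R * (3 * N.+1%:R / j%:R) :> R.
      rewrite mulrA ler_pdivlMr // -!natrM ler_nat.
      apply: leq_trans (leq_mul (count_diff_prod_primes b N j) (leqnn j)) _.
      rewrite -mulnA; apply: leq_mul; first exact: leqnSn.
      by have := leq_divM N.*2 j; rewrite mulnDl mul1n; lia.
    apply: le_trans (ler_wpM2r _ cnt) _.
      by rewrite mulr_ge0 ?divr_ge0 ?exprn_ge0 // mulr_ge0 ?(ltW C0_gt0) // ln_ge0 // ler1n.
    rewrite exprMn le_eqVlt; apply/orP; left; apply/eqP; field.
    by rewrite gt_eqF.
  rewrite -mulr_sumr.
  have := sum_ln_pow_le R s K2 KM => h.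
  apply: le_trans (ler_wpM2l _ h) _.
    by rewrite !mulr_ge0 ?exprn_ge0 ?(ltW C0_gt0).
  rewrite -/c1 -/L exprMn.
  have -> : 3 * c1 * 8 ^+ s * T = 3 * N.+1%:R * 2 ^+ s * C0 ^+ s * (c1 * (4 ^+ s * L ^+ s) * s`!%:R).
    have -> : 8 = 2 * 4 :> R by ring.
    by rewrite exprMn /T; ring.
  apply: ler_wpM2r.
    by rewrite !mulr_ge0 ?exprn_ge0 ?ler0n ?(ltW c1_gt0) ?(ltW L0).
  apply: ler_wpM2r; first by rewrite exprn_ge0 // ltW.
  apply: ler_wpM2l; first by rewrite mulr_ge0.
  by rewrite -natrX ler_nat ltnW // ltn_expl.
apply: le_trans (lerD part1 part2) _.
have e8 : 1 <= 8 ^+ s :> R by rewrite exprn_ege1 //; lra.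
have c2 : 2 + 3 * c1 <= (2 + 3 * c1) ^+ s.
  by rewrite -[leLHS]expr1; apply: ler_weXn2l => //; lra.
rewrite -/L !exprMn.
have -> : 8 ^+ s * C0 ^+ s * (2 + 3 * c1) ^+ s * L ^+ s * s`!%:R * N.+1%:R = 8 ^+ s * (2 + 3 * c1) ^+ s * T.
  by rewrite /T; ring.
rewrite -mulrDl; apply: ler_wpM2r => //.
apply: le_trans (_ : 8 ^+ s * (2 + 3 * c1) <= _); first by nra.
by apply: ler_wpM2l => //; lra.
Qed.

(** * Individual bounds and conclusion *)

(** Cutting at Y = k W ^ A: above Y there are too few prime divisors to matter,
and between the cut-off max (W, k + 1) and Y the bound (ln Y + ln 4) / ln M is at
most A + 3, because Y <= M ^ (A + 1) and 4 <= M ^ 2. *)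
Lemma totient_ratio_truncate (R : realType) (P k W A : nat) :
  (0 < P)%N -> (0 < k)%N -> (1 <= W)%N -> ln P%:R <= 2 * k%:R * W%:R ^+ A :> R ->
  P%:R / (totient P)%:R <=
  expR (A%:R + 8) * expR (recip_sum R (fun p => p \in primes P) (maxn W k.+1)).
Proof.
move=> P0 k0 W1 lnP; set M := maxn _ _; set Q := fun p => p \in primes P.
pose Y := (k * W ^ A)%N.
have Y0 : (0 < Y)%N by rewrite muln_gt0 k0 expn_gt0 W1.
have M2 : (2 <= M)%N by rewrite leq_max !ltnS k0 orbT.
have WM : (W <= M)%N by rewrite leq_maxl.
have kM : (k <= M)%N by rewrite leq_max leqnSn orbT.
apply: le_trans (totient_ratio_le_expR R P0) _.
rewrite -expRD ler_expR.
have large := sum_primes_le R P0 Y0.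
have Qpr p : Q p -> prime p by rewrite /Q mem_primes => /and3P[].
have middle := recip_sum_middle R Qpr M2 Y0.
have lnM_gt0 : 0 < ln M%:R :> R by rewrite ln_gt0 // ltr1n.
have YR : 0 < Y%:R :> R by rewrite ltr0n.
have large_le : 2 * ln P%:R / Y%:R <= 4 :> R.
  by rewrite ler_pdivrMr // /Y natrM natrX; move: lnP; lra.
have middle_le : (ln Y%:R + ln 4) / ln M%:R <= A%:R + 3 :> R.
  rewrite ler_pdivrMr // /Y natrM natrX lnM ?posrE ?exprn_gt0 ?ltr0n ?W1 //.
  rewrite lnXn ?ltr0n ?W1 // -[ln _ *+ _]mulr_natl.
  have h1 : ln k%:R <= ln M%:R :> R by rewrite ler_ln ?posrE ?ltr0n ?(ltnW M2) // ler_nat.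
  have h2 : ln W%:R <= ln M%:R :> R by rewrite ler_ln ?posrE ?ltr0n ?(ltnW M2) ?W1 // ler_nat.
  have h3 : ln 2 <= ln M%:R :> R by rewrite ler_ln ?posrE ?ltr0n ?(ltnW M2) // ler_nat.
  have := ler_wpM2l (ler0n R A) h2.
  rewrite (_ : 4 = 2 * 2 :> R) ?lnM ?posrE //; last by ring.
  lra.
lra.
Qed.

(** Each factor is at most 2 x <= x ^ 2. *)
Lemma ln_diff_prod_le (R : realType) (x : R) (k : nat) (b : 'I_k -> int) (c : int) :
  2 <= x -> (0 < diff_prod b c)%N ->
  (forall i, `|(b i)%:~R : R| <= x) -> `|c%:~R : R| <= x ->
  ln (diff_prod b c)%:R <= 2 * k%:R * ln x.
Proof.
move=> x2 P0 bx cx.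
have x0 : 0 < x by lra.
have : (diff_prod b c)%:R <= (x ^+ 2) ^+ k :> R.
  rewrite /diff_prod natr_prod -[in leRHS](card_ord k) -prodr_const.
  apply: ler_prod => i _; rewrite ler0n /= natr_absz intr_norm rmorphB /=.
  apply: le_trans (ler_normB _ _) _.
  by have := bx i; nra.
rewrite -ler_ln ?posrE ?ltr0n ?exprn_gt0 // => /le_trans; apply.
by rewrite -exprM lnXn // -[ln _ *+ _]mulr_natl natrM.
Qed.

Lemma ln_le_expn (R : realType) (eps L : R) (W A : nat) :
  0 < eps -> eps^-1 <= A%:R -> (1 <= W)%N -> 0 < L -> L `^ eps < W%:R -> L <= W%:R ^+ A.
Proof.
move=> e0 eA W1 L0 LW; rewrite leNgt; apply/negP => WL.
have W1R : 1 <= W%:R :> R by rewrite ler1n.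
have : (W%:R ^+ A) `^ eps <= L `^ eps.
  by apply: (ge0_ler_powR (ltW e0) _ _ (ltW WL)); rewrite nnegrE ?exprn_ge0 // ltW.
rewrite -powR_mulrn // -powRrM => h.
have : W%:R `^ 1 <= W%:R `^ (A%:R * eps).
  by apply: ler_powR => //; rewrite -ler_pdivrMr // mul1r.
by rewrite powRr1 //; lra.
Qed.

Lemma Delta_ratio_le (R : realType) (a k : nat) (b : 'I_k -> int) (c : int) :
  (1 <= a)%N -> (0 < diff_prod b c)%N ->
  (Delta a b c)%:R / (totient (Delta a b c))%:R <=
  a%:R / (totient a)%:R * ((diff_prod b c)%:R / (totient (diff_prod b c))%:R) :> R.
Proof.
move=> a1 P0; apply: totient_ratio_union => //.
  by rewrite muln_gt0 expn_gt0 a1.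
by move=> p; rewrite primesM ?expn_gt0 ?a1 // primesX.
Qed.

Theorem theorem1p4 (R : realType) (eps : R) (eps_gt0 : 0 < eps) (eps_lt1 : eps < 1) :
  exists2 C : R, 0 < C &
    forall (x z : R), 3 <= x -> (ln x) `^ eps <= z -> z <= x ->
    forall (k a : nat) (b : 'I_k -> int),
      (1 <= k)%N -> (1 <= a)%N -> (forall i, `|(b i)%:~R : R| <= x) ->
      injective (fun i => linear_fun a (b i)) ->
    forall s : nat, (1 <= s)%N ->
      \sum_(c \in [set c : int | - z <= (c%:~R : R) <= z /\
                     ~ range (fun i => linear_fun a (b i)) (linear_fun a c)])
         ((Delta a b c)%:R / (totient (Delta a b c))%:R : R) ^+ s
      <= (C * (a%:R / (totient a)%:R) * ln (k%:R + 1)) ^+ s * s`!%:R * z.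
Proof.
have [C1 C1_gt0 HC1] := moment_le R.
pose A := (Num.truncn eps^-1).+1.
have epsA : eps^-1 <= A%:R.
  by apply: ltW; rewrite truncnS_gt.
exists (3 * expR (A%:R + 8) * C1); first by rewrite !mulr_gt0 ?expR_gt0.
move=> x z x3 Lz zx k a b k1 a1 bx _ s s1.
(* The weak bound 1 / 2 <= ln x suffices to keep z away from 0, and then
   N + 1 <= 3 z. *)
have L_ge : 2^-1 <= ln x.
  by apply: le_trans (ln2_ge_half R) _; rewrite ler_ln ?posrE //; lra.
have z_ge : 2^-1 <= z.
  apply: le_trans Lz; apply: le_trans (_ : 2^-1 `^ eps <= _); last first.
    by apply: (ge0_ler_powR (ltW eps_gt0) _ _ L_ge); rewrite nnegrE ?invr_ge0 //; lra.
  rewrite -{1}[2^-1]powRr1 ?invr_ge0 //; apply: ger_powR; last exact: ltW.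
  by rewrite invr_gt0 ltr0n /= invf_le1 // ler1n.
pose N := Num.truncn z; have z0 : 0 <= z by lra.
have Nz : N%:R <= z by rewrite /N truncn_le.
have zN : z < N.+1%:R by rewrite truncnS_gt.
set S := [set c | _]; set F := fun c : int => _.
have S_sub c : S c -> c \in int_window N.
  move=> [/andP[c1 c2] _]; apply: mem_int_window.
  rewrite /N truncn_ge_nat // natr_absz intr_norm ler_norml c1 c2 //.
have -> : \sum_(c \in S) F c = \sum_(c <- int_window N | c \in S) F c.
  rewrite (@fsbigE _ _ _ _ _ [seq c <- int_window N | c \in S]).
  - by rewrite big_filter_cond; apply: eq_bigl => c; rewrite andbb.
  - by rewrite filter_uniq // int_window_uniq.
  - move=> c Sc; have : c \in [seq c <- int_window N | c \in S] := Sc.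
    by rewrite mem_filter => /andP[/set_mem].
  - by move=> c Sc; rewrite mem_filter (S_sub c Sc) mem_set.
set fa : R := a%:R / (totient a)%:R; set E : R := expR (A%:R + 8).
have fa0 : 0 <= fa by rewrite divr_ge0.
have E0 : 0 < E by rewrite expR_gt0.
pose Q c p := p \in primes (diff_prod b c).
have term c : c \in S ->
    F c <= (fa * E) ^+ s * expR (s%:R * recip_sum R (Q c) (maxn N.+1 k.+1)).
  move=> /set_mem[/andP[c1 c2] not_range].
  have P0 : (0 < diff_prod b c)%N.
    rewrite /diff_prod prodn_gt0 // => i; rewrite absz_gt0 subr_eq0.
    by apply/eqP => bc; apply: not_range; exists i => //=; rewrite bc.
  rewrite expRM_natl -exprMn; apply: lerXn2r; rewrite ?nnegrE ?divr_ge0 //.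
    by rewrite !mulr_ge0 ?expR_ge0.
  apply: le_trans (Delta_ratio_le R a1 P0) _.
  rewrite -/fa -[leRHS]mulrA; apply: ler_wpM2l => //.
  (* Since (ln x) ^ eps <= z < N + 1 and A eps >= 1. *)
  have Wx : ln x <= N.+1%:R ^+ A.
    by apply: (ln_le_expn eps_gt0) => //; [lra | apply: le_lt_trans zN].
  apply: totient_ratio_truncate => //.
  apply: le_trans (ln_diff_prod_le _ P0 bx _) _; first by lra.
    by rewrite (le_trans _ zx) // ler_norml c1 c2.
  by apply: ler_wpM2l => //; rewrite mulr_ge0.
rewrite big_mkcond.
apply: le_trans (_ : \sum_(c <- int_window N)
    (fa * E) ^+ s * expR (s%:R * recip_sum R (Q c) (maxn N.+1 k.+1)) <= _).
  apply: ler_sum => c _; case: ifP => [/term //|_].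
  by rewrite mulr_ge0 ?expR_ge0 // exprn_ge0 // mulr_ge0 // ltW.
rewrite -mulr_sumr; apply: le_trans (ler_wpM2l _ (HC1 N k b s k1 s1)) _.
  by rewrite exprn_ge0 // mulr_ge0 // ltW.
rewrite natr1; set L : R := ln k.+1%:R.
have L0 : 0 <= L by rewrite ln_ge0 // ler1n.
have N3 : N.+1%:R <= 3 ^+ s * z.
  apply: le_trans (_ : 3 * z <= _); first by rewrite -natr1; lra.
  apply: ler_wpM2r => //; rewrite -[leLHS]expr1; apply: ler_weXn2l => //; lra.
have -> : (3 * E * C1 * fa * L) ^+ s * s`!%:R * z =
    (fa * E) ^+ s * ((C1 * L) ^+ s * s`!%:R * (3 ^+ s * z)).
  by rewrite !exprMn; ring.
apply: ler_wpM2l; first by rewrite exprn_ge0 // mulr_ge0 // ltW.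
apply: ler_wpM2l => //; rewrite mulr_ge0 // exprn_ge0 // mulr_ge0 //; exact: ltW.
Qed.
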